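(* Let $C_{12},C_{13},C_{23}$ be compatible bivariate copulas, let $C_{ji}(u,v):=C_{ij}(v,u)$ for $1\le i<j\le 3$, and let $\mathcal P=\{(1,2,3),(1,3,2),(2,1,3)\}$. Then for every $3$-copula $\widetilde C$ with $\widetilde C(u_1,u_2,1)=C_{12}(u_1,u_2)$, $\widetilde C(u_1,1,u_3)=C_{13}(u_1,u_3)$, $\widetilde C(1,u_2,u_3)=C_{23}(u_2,u_3)$, and all $u_1,u_2,u_3\in[0,1]$, \[ C_L(u_1,u_2,u_3)\le\widetilde C(u_1,u_2,u_3)\le C_U(u_1,u_2,u_3), \] where \[ C_L(u_1,u_2,u_3)=\max_{(i,j,k)\in\mathcal P}\max\Big\{(C_{ij}\star_{W_2}C_{jk})(u_i,u_j,u_k),\ (C_{ij}\star_{M_2}C_{jk})(u_i,u_j,u_k)+C_{ik}(u_i,u_k)-(C_{ij}\ast_{M_2}C_{jk})(u_i,u_k)\Big\}, \] \[ C_U(u_1,u_2,u_3)=\min_{(i,j,k)\in\mathcal P}\min\Big\{(C_{ij}\star_{M_2}C_{jk})(u_i,u_j,u_k),\ (C_{ij}\star_{W_2}C_{jk})(u_i,u_j,u_k)+C_{ik}(u_i,u_k)-(C_{ij}\ast_{W_2}C_{jk})(u_i,u_k)\Big\}. \]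
   Context: A bivariate copula is a distribution function on $[0,1]^2$ with uniform $[0,1]$ marginals; a $3$-copula is a distribution function on $[0,1]^3$ with uniform $[0,1]$ one-dimensional marginals. Bivariate copulas are compatible if they are the bivariate marginals (in the sense stated in the claim) of some $3$-copula. $W_2(u,v)=\max\{u+v-1,0\}$, $M_2(u,v)=\min\{u,v\}$. For bivariate copulas $A,B$ and a bivariate copula $C$: $(A\ast_{C} B)(x,z)=\int_{0}^{1} C\!\left(\tfrac{\partial}{\partial t} A(x,t),\tfrac{\partial}{\partial t} B(t,z)\right) dt$ and $(A\star_{C} B)(x,y,z)=\int_{0}^{y} C\!\left(\tfrac{\partial}{\partial t} A(x,t),\tfrac{\partial}{\partial t} B(t,z)\right) dt$, the partial derivatives existing for almost every $t$. *)

(* Defs.v *)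
From HB Require Import structures.
From mathcomp Require Import all_boot all_order all_algebra.
From mathcomp Require Import all_classical all_reals all_analysis.
Set Implicit Arguments. Unset Strict Implicit. Unset Printing Implicit Defensive.
Import Order.TTheory GRing.Theory Num.Theory.
Import numFieldNormedType.Exports.
Local Open Scope classical_set_scope.
Local Open Scope ring_scope.

Section Copulas.
Variable R : realType.

Definition unit_int (u : R) := 0 <= u <= 1.

Definition is_copula2 (C : R -> R -> R) : Prop :=
  (forall u, unit_int u -> C u 0 = 0 /\ C 0 u = 0 /\ C u 1 = u /\ C 1 u = u) /\
  (forall u1 u2 v1 v2, 0 <= u1 -> u1 <= u2 -> u2 <= 1 ->
     0 <= v1 -> v1 <= v2 -> v2 <= 1 ->
     0 <= C u2 v2 - C u2 v1 - C u1 v2 + C u1 v1).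

Definition is_copula3 (C : R -> R -> R -> R) : Prop :=
  (forall u v, unit_int u -> unit_int v ->
     C 0 u v = 0 /\ C u 0 v = 0 /\ C u v 0 = 0) /\
  (forall u, unit_int u -> C u 1 1 = u /\ C 1 u 1 = u /\ C 1 1 u = u) /\
  (forall a1 b1 a2 b2 a3 b3, 0 <= a1 -> a1 <= b1 -> b1 <= 1 ->
     0 <= a2 -> a2 <= b2 -> b2 <= 1 -> 0 <= a3 -> a3 <= b3 -> b3 <= 1 ->
     0 <= C b1 b2 b3 - C a1 b2 b3 - C b1 a2 b3 - C b1 b2 a3
          + C a1 a2 b3 + C a1 b2 a3 + C b1 a2 a3 - C a1 a2 a3).

Definition has_margins (C : R -> R -> R -> R) (C12 C13 C23 : R -> R -> R) : Prop :=
  forall u1 u2 u3, unit_int u1 -> unit_int u2 -> unit_int u3 ->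
    C u1 u2 1 = C12 u1 u2 /\ C u1 1 u3 = C13 u1 u3 /\ C 1 u2 u3 = C23 u2 u3.

Definition compatible (C12 C13 C23 : R -> R -> R) : Prop :=
  exists C, is_copula3 C /\ has_margins C C12 C13 C23.

Definition W2 (u v : R) : R := Num.max (u + v - 1) 0.
Definition M2 (u v : R) : R := Num.min u v.

Definition ast (C A B : R -> R -> R) (x z : R) : R :=
  (\int[@lebesgue_measure R]_(t in `[0, 1]%classic)
     C (derive1 (fun s => A x s) t) (derive1 (fun s => B s z) t))%R.

Definition star (C A B : R -> R -> R) (x y z : R) : R :=
  (\int[@lebesgue_measure R]_(t in `[0, y]%classic)
     C (derive1 (fun s => A x s) t) (derive1 (fun s => B s z) t))%R.

Definition Cpair (C12 C13 C23 : R -> R -> R) (i j : nat) : R -> R -> R :=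
  match i, j with
  | 1%N, 2%N => C12 | 2%N, 1%N => fun u v => C12 v u
  | 1%N, 3%N => C13 | 3%N, 1%N => fun u v => C13 v u
  | 2%N, 3%N => C23 | 3%N, 2%N => fun u v => C23 v u
  | _, _ => fun _ _ => 0%R
  end.

Definition uidx (u1 u2 u3 : R) (i : nat) : R :=
  match i with 1%N => u1 | 2%N => u2 | _ => u3 end.

Definition lower_term C12 C13 C23 (u1 u2 u3 : R) (i j k : nat) : R :=
  let Cij := Cpair C12 C13 C23 i j in
  let Cjk := Cpair C12 C13 C23 j k in
  let Cik := Cpair C12 C13 C23 i k in
  let ui := uidx u1 u2 u3 i in let uj := uidx u1 u2 u3 j in
  let uk := uidx u1 u2 u3 k in
  Num.max (star W2 Cij Cjk ui uj uk)
          (star M2 Cij Cjk ui uj uk + Cik ui uk - ast M2 Cij Cjk ui uk).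

Definition upper_term C12 C13 C23 (u1 u2 u3 : R) (i j k : nat) : R :=
  let Cij := Cpair C12 C13 C23 i j in
  let Cjk := Cpair C12 C13 C23 j k in
  let Cik := Cpair C12 C13 C23 i k in
  let ui := uidx u1 u2 u3 i in let uj := uidx u1 u2 u3 j in
  let uk := uidx u1 u2 u3 k in
  Num.min (star M2 Cij Cjk ui uj uk)
          (star W2 Cij Cjk ui uj uk + Cik ui uk - ast W2 Cij Cjk ui uk).

Definition C_L C12 C13 C23 (u1 u2 u3 : R) : R :=
  Num.max (lower_term C12 C13 C23 u1 u2 u3 1 2 3)
   (Num.max (lower_term C12 C13 C23 u1 u2 u3 1 3 2)
            (lower_term C12 C13 C23 u1 u2 u3 2 1 3)).

Definition C_U C12 C13 C23 (u1 u2 u3 : R) : R :=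
  Num.min (upper_term C12 C13 C23 u1 u2 u3 1 2 3)
   (Num.min (upper_term C12 C13 C23 u1 u2 u3 1 3 2)
            (upper_term C12 C13 C23 u1 u2 u3 2 1 3)).

End Copulas.

(* Main.v *)
Require Import Defs.
From HB Require Import structures.
From mathcomp Require Import all_boot all_order all_algebra.
From mathcomp Require Import all_classical all_reals all_analysis.
From mathcomp Require Import measurable_realfun lra ring.
Set Implicit Arguments. Unset Strict Implicit. Unset Printing Implicit Defensive.
Import Order.TTheory GRing.Theory Num.Theory.
Import numFieldNormedType.Exports.
Local Open Scope classical_set_scope.
Local Open Scope ring_scope.

(** Fix x and z and follow a 3-copula along t: H t = C(x,t,z), F t = C(x,t,1),
    G t = C(1,t,z). Nonnegativity of box volumes makes H, F - H, G - H and
    t - F - G + H nondecreasing, so F, G, H are 1-Lipschitz, hence integrals of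
    their almost everywhere derivatives, and W_2(F',G') <= H' <= M_2(F',G') almost
    everywhere. Integrating over [0,y] bounds H y, integrating over [y,1] bounds
    H 1 - H y; permuting the coordinates of C gives the three families. *)

(** * Integrals under almost everywhere comparison, without measurability *)

Section ae_integral.
Context d (T : measurableType d) (R : realType).
Variable mu : {measure set T -> \bar R}.
Implicit Types (f g : T -> \bar R).
Import HBNNSimple.
Local Open Scope ereal_scope.

(* No measurability of [f] and [g]: a simple function below [f] is cut down to 0 on
   the null set. This is what allows [derive1] of an arbitrary function below. *)
Lemma ae_ge0_le_integralT f g : (forall x, 0 <= f x) -> (forall x, 0 <= g x) ->
  {ae mu, forall x, f x <= g x} -> \int[mu]_x f x <= \int[mu]_x g x.
Proof.
move=> f0 g0 [N [mN muN fgN]].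
rewrite !ge0_integralTE//; apply: ge_ereal_sup => _ [h /= hf <-].
pose hN := proj_nnsfun h (measurableC mN).
have sintE (k : {nnsfun T >-> R}) : sintegral mu k = \int[mu]_(x in ~` N) (k x)%:E.
  rewrite -setTD -ge0_negligible_integral//.
  - by rewrite integral_nnsfun// patch_setT.
  - exact/measurable_EFinP.
  - by move=> x _; rewrite lee_fin.
have -> : sintegral mu h = sintegral mu hN.
  rewrite !sintE; apply: eq_integral => x xN.
  by rewrite /hN /= mindicE xN mulr1.
apply: ereal_sup_ubound; exists hN => //= x.
rewrite mindicE; have [|xN] := boolP (x \in ~` N); last by rewrite mulr0.
rewrite inE mulr1 => xN; apply: le_trans (hf x) _.
by move/subsetCl : fgN; apply.
Qed.

(** Positive and negative parts are compared separately, each in both directions by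
    [ae_ge0_le_integralT] after extension by 0 outside [D]. *)
Lemma eq_ae_integral (D : set T) f g : ae_eq mu D f g ->
  \int[mu]_(x in D) f x = \int[mu]_(x in D) g x.
Proof.
have key u v : (forall x, 0 <= u x) -> (forall x, 0 <= v x) ->
    ae_eq mu D u v -> \int[mu]_(x in D) u x = \int[mu]_(x in D) v x.
  move=> u0 v0 uv; rewrite [LHS]integral_mkcond [RHS]integral_mkcond.
  by apply/eqP; rewrite eq_le; apply/andP; split; apply: ae_ge0_le_integralT;
    try (by move=> x; apply: erestrict_ge0); move: uv; apply: filterS => x;
    rewrite !patchE; case: ifPn => //; rewrite inE => Dx /(_ Dx) ->.
move=> /ae_eq_funeposneg[fgp fgn].
by rewrite [LHS]integralE [RHS]integralE; congr (_ - _); apply: key.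
Qed.

Lemma eq_ae_Rintegral (D : set T) (f g : T -> R) : ae_eq mu D f g ->
  (\int[mu]_(x in D) f x = \int[mu]_(x in D) g x)%R.
Proof. by move=> fg; congr fine; apply: eq_ae_integral; apply: ae_eq_comp fg. Qed.

End ae_integral.

(** * Nondecreasing 1-Lipschitz functions and their Radon-Nikodym densities *)

Section lipschitz_density.
Context {R : realType}.
Notation mu := (@lebesgue_measure R).

Lemma lebesgue_stieltjes_measure_itvoc (F : cumulative R R) (a b : R) : a <= b ->
  lebesgue_stieltjes_measure F `]a, b]%classic = (F b - F a)%:E.
Proof.
move=> ab; rewrite /lebesgue_stieltjes_measure/= /measure_extension/=.
by rewrite measurable_mu_extE; [exact: wlength_itv_bnd|exact: is_ocitv].
Qed.

Lemma lipschitz1_right_continuous (F : R -> R) :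
  (forall s t, s <= t -> 0 <= F t - F s <= t - s) -> right_continuous F.
Proof.
move=> FL; apply: right_continuousW => x.
apply/cvgrPdist_le => e e0; near=> y.
have xy : `|x - y| <= e by near: y; apply: cvgr_dist_le.
apply: le_trans xy; have [xy|yx] := leP x y.
- have /andP[h1 h2] := FL _ _ xy.
  by rewrite distrC (distrC x) !ger0_norm// subr_ge0.
- have /andP[h1 h2] := FL _ _ (ltW yx).
  by rewrite !ger0_norm// subr_ge0 ltW.
Unshelve. all: by end_near. Qed.

(** The slope bound makes [t - F t] a cumulative function too, and its Stieltjes measure is exactly
    what that of [F] lacks to be Lebesgue measure. *)
Lemma lipschitz1_stieltjes_dominated (F : cumulative R R) :
  (forall s t, s <= t -> F t - F s <= t - s) ->
  lebesgue_stieltjes_measure F `<< mu.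
Proof.
move=> FL.
have GL s t : s <= t -> 0 <= (t - F t) - (s - F s) <= t - s.
  move=> st; have := FL _ _ st; have := cumulative_is_nondecreasing F _ _ st.
  by move=> *; apply/andP; split; lra.
have ndG : {homo (fun t => t - F t) : s t / s <= t}.
  by move=> s t st; rewrite -subr_ge0; have /andP[] := GL s t st.
pose Gc := isCumulative.Build R _ R (fun t => t - F t)
  ndG (lipschitz1_right_continuous GL).
pose G : cumulative R R := HB.pack (fun t => t - F t) Gc.
pose nF := lebesgue_stieltjes_measure F.
pose nG := lebesgue_stieltjes_measure G.
apply/null_content_dominatesP => A mA A0.
(* The Stieltjes measures of [F] and [t - F t] sum to Lebesgue measure. *)
have : mu A = measure_add nF nG A.
  apply: lebesgue_measure_unique mA => X /ocitvP[->|[[a b] /= ab ->]].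
    by rewrite !measure0.
  rewrite [RHS]measure_addE.
  transitivity ((b - a)%:E); first exact: (lebesgue_stieltjes_measure_itvoc idfun (ltW ab)).
  transitivity ((F b - F a)%:E + (G b - G a)%:E)%E.
    by rewrite -EFinD /=; congr EFin; ring.
  by congr (_ + _)%E; apply/esym/lebesgue_stieltjes_measure_itvoc/ltW.
rewrite [X in _ = X]measure_addE A0 => /esym/eqP; rewrite padde_eq0// => /andP[/eqP + _].
exact.
Qed.

(** Here [f] is the Radon-Nikodym density of the Stieltjes measure of [F]. Differentiating its
    integral identifies it almost everywhere with the derivative of [F]. *)
Lemma lipschitz1_density (F : R -> R) (a b : R) : a <= b ->
  (forall s t, a <= s -> s <= t -> t <= b -> 0 <= F t - F s <= t - s) ->
  exists f : R -> R, [/\ mu.-integrable setT (EFin \o f),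
    {ae mu, forall t, a < t < b -> derivable F t 1 /\ derive1 F t = f t} &
    forall s t, a <= s -> s <= t -> t <= b ->
      \int[mu]_(x in `[s, t]) f x = F t - F s].
Proof.
move=> ab FL.
(* Clamping to [[a, b]]: a cumulative function lives on the whole line, whereas [F] is controlled
   only on [[a, b]]. *)
pose c t := Num.max a (Num.min t b).
have cE t : a <= t -> t <= b -> c t = t.
  by move=> ? ?; rewrite /c min_l// max_r.
have cL s t : s <= t -> [/\ a <= c s, c s <= c t, c t <= b & c t - c s <= t - s].
  by rewrite /c /Num.max /Num.min => st; split; do ![case: ifPn]; lra.
have FcL s t : s <= t -> 0 <= F (c t) - F (c s) <= t - s.
  move=> /cL[h1 h2 h3 h4]; have /andP[-> /le_trans->//] := FL _ _ h1 h2 h3.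
have ndF : {homo (F \o c) : s t / s <= t}.
  by move=> s t st; rewrite -subr_ge0; have /andP[] := FcL s t st.
pose G : cumulative R R := HB.pack (F \o c)
  (isCumulative.Build R _ R (F \o c) ndF (lipschitz1_right_continuous FcL)).
pose nG := lebesgue_stieltjes_measure G.
have GE s t : s <= t -> nG `]s, t]%classic = (F (c t) - F (c s))%:E.
  exact: lebesgue_stieltjes_measure_itvoc.
have fin : (nG `]a, b]%classic < +oo)%E by rewrite GE// ltry.
have mD : measurable (`]a, b]%classic : set (measurableTypeR R)) by exact: measurable_itv.
pose nu : {finite_measure set (measurableTypeR R) -> \bar R} := mfrestr mD fin.
have numu : nu `<< mu.
  have /null_content_dominatesP dom : nG `<< mu.
    by apply: lipschitz1_stieltjes_dominated => s t /FcL/andP[].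
  apply/null_content_dominatesP => A mA A0.
  apply: dom; first exact: measurableI.
  by apply: (subset_measure0 _ _ _ A0) => //; exact: measurableI.
have [f [f0 ffin intf nuE]] := radon_nikodym_sigma_finite numu.
exists (fine \o f).
have fE : EFin \o (fine \o f) = f by apply/funext => x /=; rewrite fineK.
have intf' : mu.-integrable setT (EFin \o (fine \o f)) by rewrite fE.
have intE s t : a <= s -> s <= t -> t <= b ->
    \int[mu]_(x in `[s, t]) fine (f x) = F t - F s.
  move=> as_ st tb.
  (* Stieltjes measures are computed on half-open intervals; the added endpoint is Lebesgue null. *)
  rewrite -Rintegral_itv_obnd_cbnd; last exact: integrableS intf'.
  rewrite /Rintegral; under eq_integral do rewrite fineK//.
  rewrite -nuE//= /nu /mfrestr /mrestr setIidl; last first.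
    by apply: subset_itv; rewrite bnd_simp.
  by rewrite [X in fine X](GE _ _ st)/= !cE// ?(le_trans st)// (le_trans as_).
split=> //.
have intfy y : mu.-integrable [set` Interval (BLeft a) (BRight y)] (EFin \o (fine \o f)).
  exact: integrableS intf'.
have := FTC1 intfy (open_integrable_locally openT intf').
apply: filterS; first exact: (ae_filter_ringOfSetsType mu).
move=> t + /andP[at_ tb].
rewrite /= lte_fin => /(_ at_); set P := fun x => _.
move=> [dP P'].
(* The derivative found is that of the integral [P], which matches [F] up to a constant only inside
   []a, b[]; a neighbourhood of [t] is enough to transfer it. *)
have near_eq : \forall x \near t, P x + F a = F x.
  near=> x.
  have : x \in `]a, b[ by near: x; apply: near_in_itvoo; rewrite in_itv/= at_.
  rewrite in_itv/= => /andP[ax xb].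
  by rewrite /P intE ?subrK// ltW.
have dPF : is_derive t 1 (fun x => P x + F a) (fine (f t)).
  have -> : fine (f t) = fine (f t) + 0 by rewrite addr0.
  apply: (@is_deriveD _ _ _ P (cst (F a))).
  by apply: (DeriveDef dP); rewrite -derive1E P'.
have [dF <-] := near_eq_is_derive near_eq dPF.
by rewrite derive1E.
Unshelve. all: by end_near. Qed.

End lipschitz_density.

(** * Pointwise bounds on densities and their integrated form *)

Section coupling.
Context {R : realType}.
Notation mu := (@lebesgue_measure R).
#[local] Instance ae_lebesgue_filter : Filter (nbhs (almost_everywhere mu)) :=
  ae_filter_ringOfSetsType mu.
Implicit Types (F G H f g h : R -> R).

Lemma nondecreasing_derive1_ge0 F (a b t : R) : a < t < b ->
  (forall s u, a <= s -> s <= u -> u <= b -> F s <= F u) ->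
  derivable F t 1 -> 0 <= derive1 F t.
Proof.
move=> /andP[at_ tb] ndF dF; apply: limr_ge.
  by under eq_fun do rewrite -[X in F (X + _)]scaler1.
have cvgt : x + t @[x --> 0^'] --> 0 + t.
  by apply: cvg_within_filter; apply: cvgD; [exact: cvg_id|exact: cvg_cst].
have near_ab : \forall x \near 0^', x + t \in `]a, b[.
  apply: (cvgt (fun z => z \in `]a, b[)); rewrite add0r.
  by apply: near_in_itvoo; rewrite in_itv/= at_.
near=> x.
have x0 : x != 0 by near: x; exact: nbhs_dnbhs_neq.
have : x + t \in `]a, b[ by near: x.
rewrite in_itv/= => /andP[axt xtb]; move: x0; rewrite neq_lt => /orP[x0|x0].
- by rewrite nmulr_rge0 ?invr_lt0// subr_le0; apply: ndF; lra.
- by rewrite pmulr_rge0 ?invr_gt0// subr_ge0; apply: ndF; lra.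
Unshelve. all: by end_near. Qed.

Lemma ae_le_Rintegral (D : set R) f g : measurable D ->
  mu.-integrable D (EFin \o f) -> mu.-integrable D (EFin \o g) ->
  {ae mu, forall t, D t -> f t <= g t} ->
  \int[mu]_(t in D) f t <= \int[mu]_(t in D) g t.
Proof.
move=> mD intf intg fg; rewrite -subr_ge0 -RintegralB//.
(* Nonnegativity holds only almost everywhere; the absolute value makes it hold everywhere without
   changing the integral. *)
have -> : \int[mu]_(t in D) (g t - f t) = \int[mu]_(t in D) `|g t - f t|.
  apply: eq_ae_Rintegral; move: fg.
  by apply: filterS => t fg Dt; rewrite ger0_norm// subr_ge0 fg.
exact: Rintegral_ge0.
Qed.

(** Domination by [|f| + |g|]; both [W2] and [M2] satisfy the growth condition on all of [R]. *)
Lemma integrable_comp2_bounded (K : R -> R -> R) f g :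
  (forall u v, `|K u v| <= `|u| + `|v|) ->
  measurable_fun setT (fun t => K (f t) (g t)) ->
  mu.-integrable setT (EFin \o f) -> mu.-integrable setT (EFin \o g) ->
  mu.-integrable setT (EFin \o (fun t => K (f t) (g t))).
Proof.
move=> Kle mK intf intg.
apply: (le_integrable _ _ _ (integrableD _ (integrable_abse intf) (integrable_abse intg))) => //.
  exact/measurable_EFinP.
by move=> t _ /=; rewrite lee_fin (le_trans (Kle _ _))// ler_norm.
Qed.

(* When [H t = C x t z], [F t = C x t 1] and [G t = C 1 t z] for a 3-copula [C],
   the four inequalities say that [C] gives nonnegative volume to the four boxes
   cut out of [0,1] x [s,t] x [0,1] by the planes u_1 = x and u_3 = z. *)
Definition coupled F G H := forall s t, 0 <= s -> s <= t -> t <= 1 ->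
  [/\ 0 <= H t - H s, H t - H s <= F t - F s, H t - H s <= G t - G s &
      (F t - F s) + (G t - G s) - (H t - H s) <= t - s].

Lemma ae_itv01 (P : R -> Prop) : {ae mu, forall t, 0 < t < 1 -> P t} ->
  {ae mu, forall t, 0 <= t <= 1 -> P t}.
Proof.
have ae_neq (x : R) : {ae mu, forall t, t != x}.
  exists [set x]; split; [exact: measurable_set1|exact: lebesgue_measure_set1|].
  by move=> t /= /negP; rewrite negbK => /eqP.
move=> Pt; near=> t => /andP[t0 t1].
apply: (near Pt t) => //.
by rewrite !lt_neqAle t0 t1 (near (ae_neq 1) t)// eq_sym (near (ae_neq 0) t).
Unshelve. all: by end_near. Qed.

(* The derivatives may be junk at points of nondifferentiability and at 0 and 1,
   where they depend on values outside [0,1]; only a null set is affected. *)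
Lemma coupled_densities F G H : coupled F G H ->
  exists f g h, [/\ mu.-integrable setT (EFin \o f),
    mu.-integrable setT (EFin \o g), mu.-integrable setT (EFin \o h),
    {ae mu, forall t, 0 <= t <= 1 ->
      [/\ derive1 F t = f t, derive1 G t = g t, W2 (f t) (g t) <= h t &
          h t <= M2 (f t) (g t)]} &
    forall s t, 0 <= s -> s <= t -> t <= 1 ->
      \int[mu]_(x in `[s, t]) h x = H t - H s].
Proof.
move=> FGH.
have LF s t : 0 <= s -> s <= t -> t <= 1 -> 0 <= F t - F s <= t - s.
  by move=> s0 st t1; have [? ? ? ?] := FGH _ _ s0 st t1; apply/andP; split; lra.
have LG s t : 0 <= s -> s <= t -> t <= 1 -> 0 <= G t - G s <= t - s.
  by move=> s0 st t1; have [? ? ? ?] := FGH _ _ s0 st t1; apply/andP; split; lra.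
have LH s t : 0 <= s -> s <= t -> t <= 1 -> 0 <= H t - H s <= t - s.
  by move=> s0 st t1; have [? ? ? ?] := FGH _ _ s0 st t1; apply/andP; split; lra.
have [f [intf f' _]] := lipschitz1_density ler01 LF.
have [g [intg g' _]] := lipschitz1_density ler01 LG.
have [h [inth h' hE]] := lipschitz1_density ler01 LH.
exists f, g, h; split=> //; apply: ae_itv01.
move: f' g' h'; apply: filterS3 => t f't g't h't t01.
have [dF fE] := f't t01; have [dG gE] := g't t01; have [dH hE'] := h't t01.
(* To be applied to [H], [F - H], [G - H] and [id - (F + G - H)], which [coupled] makes
   nondecreasing on [0,1]. The last yields [f t + g t - 1 <= h t], the nontrivial half of the [W2]
   bound. *)
have D (E : R -> R) e : is_derive t 1 E e ->
    (forall s u, 0 <= s -> s <= u -> u <= 1 -> E s <= E u) -> 0 <= e.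
  move=> [dE <-] ndE; rewrite -derive1E.
  exact: nondecreasing_derive1_ge0 t01 ndE dE.
have iF : is_derive t 1 F (f t) by apply: (DeriveDef dF); rewrite -derive1E.
have iG : is_derive t 1 G (g t) by apply: (DeriveDef dG); rewrite -derive1E.
have iH : is_derive t 1 H (h t) by apply: (DeriveDef dH); rewrite -derive1E.
have h0 : 0 <= h t.
  by apply: (D H) => // s u s0 su u1; have [? ? ? ?] := FGH _ _ s0 su u1; lra.
have hf : 0 <= f t - h t.
  by apply: (D (F - H)) => // s u s0 su u1; have [? ? ? ?] := FGH _ _ s0 su u1;
    rewrite !fctE; lra.
have hg : 0 <= g t - h t.
  by apply: (D (G - H)) => // s u s0 su u1; have [? ? ? ?] := FGH _ _ s0 su u1;
    rewrite !fctE; lra.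
have hfg : 0 <= 1 - (f t + g t - h t).
  by apply: (D (id - (F + G - H))) => // s u s0 su u1;
    have [? ? ? ?] := FGH _ _ s0 su u1; rewrite !fctE; lra.
split=> //.
  by rewrite /W2 ge_max h0 andbT; lra.
by rewrite /M2 le_min; apply/andP; split; lra.
Qed.

Lemma coupled_integral_bounds F G H (y : R) : coupled F G H -> 0 <= y <= 1 ->
  let I (K : R -> R -> R) b := \int[mu]_(t in `[0, b]) K (derive1 F t) (derive1 G t) in
  [/\ I (@W2 R) y <= H y - H 0, H y - H 0 <= I (@M2 R) y,
      I (@W2 R) 1 - I (@W2 R) y <= H 1 - H y & H 1 - H y <= I (@M2 R) 1 - I (@M2 R) y].
Proof.
move=> FGH /andP[y0 y1] I.
have [f [g [h [intf intg inth fgh hE]]]] := coupled_densities FGH.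
(* From here on the densities replace the derivatives, since integrability is known for the
   densities. *)
have IE K b : b <= 1 -> I K b = \int[mu]_(t in `[0, b]) K (f t) (g t).
  move=> b1; apply: eq_ae_Rintegral; move: fgh; apply: filterS => t fgh /=.
  rewrite in_itv/= => /andP[t0 tb].
  by have [-> -> _ _] := fgh (introT andP (conj t0 (le_trans tb b1))).
have [mf mg] : measurable_fun setT f /\ measurable_fun setT g.
  by split; apply/measurable_EFinP; [case/integrableP: intf|case/integrableP: intg].
have intW : mu.-integrable setT (EFin \o (fun t => W2 (f t) (g t))).
  apply: integrable_comp2_bounded => //.
    move=> u v; rewrite (le_trans _ (ler_normD u v))// /W2.
    have := ler_norm (u + v); have := normr_ge0 (u + v).
    by rewrite (@ger0_norm _ (Num.max _ _)) ?le_max ?lexx ?orbT// ge_max; lra.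
  apply: measurable_maxr => //; apply: measurable_funB => //.
  exact: measurable_funD.
have intM : mu.-integrable setT (EFin \o (fun t => M2 (f t) (g t))).
  apply: integrable_comp2_bounded => //; last exact: measurable_minr.
  move=> u v; rewrite /M2 /Num.min; have := normr_ge0 u; have := normr_ge0 v.
  by case: ifP => _; lra.
(* The difference is an integral over []y, 1]], closed at [y] at no cost; this turns bounds over
   [[y, 1]] into the last two inequalities. *)
have tail K : mu.-integrable setT (EFin \o (fun t => K (f t) (g t))) ->
    I K 1 - I K y = \int[mu]_(t in `[y, 1]) K (f t) (g t).
  move=> intK; rewrite !IE// Rintegral_itvB ?bnd_simp//.
    by apply: Rintegral_itv_obnd_cbnd; exact: integrableS intK.
  exact: integrableS intK.
have leI (a b : R) : 0 <= a -> a <= b -> b <= 1 ->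
    \int[mu]_(t in `[a, b]) W2 (f t) (g t) <= H b - H a /\
    H b - H a <= \int[mu]_(t in `[a, b]) M2 (f t) (g t).
  move=> a0 ab b1; rewrite -hE//.
  split; apply: ae_le_Rintegral => //; try exact: (integrableS _ _ _ inth);
    try exact: (integrableS _ _ _ intW); try exact: (integrableS _ _ _ intM).
  - move: fgh; apply: filterS => t fgh /=; rewrite in_itv/= => /andP[at_ tb].
    by have [] := fgh (introT andP (conj (le_trans a0 at_) (le_trans tb b1))).
  - move: fgh; apply: filterS => t fgh /=; rewrite in_itv/= => /andP[at_ tb].
    by have [] := fgh (introT andP (conj (le_trans a0 at_) (le_trans tb b1))).
rewrite !tail// !IE//.
have [? ?] := leI _ _ (lexx 0) y0 y1; have [? ?] := leI _ _ y0 y1 (lexx 1).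
by split.
Qed.

(** * Sections of a 3-copula and permutation of its coordinates *)

Lemma copula3_section_coupled (C : R -> R -> R -> R) F G (x z : R) :
  is_copula3 C -> unit_int x -> unit_int z ->
  (forall t, unit_int t -> C x t 1 = F t) ->
  (forall t, unit_int t -> C 1 t z = G t) ->
  coupled F G (fun t => C x t z).
Proof.
move=> [C0 [C1 vol]] /[dup] ux /andP[x0 x1] /[dup] uz /andP[z0 z1] CF CG s t s0 st t1.
have us : unit_int s by apply/andP; split; lra.
have ut : unit_int t by apply/andP; split; lra.
have u1 : unit_int (1 : R) by apply/andP; split; lra.
(* The volumes of the four boxes are, in order, the increments over [[s, t]] of [H], [F - H],
   [G - H] and [t - F - G + H], once the boundary values of [C] are substituted. *)
have := vol 0 x s t 0 z (lexx _) x0 x1 s0 st t1 (lexx _) z0 z1.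
have := vol 0 x s t z 1 (lexx _) x0 x1 s0 st t1 z0 z1 (lexx _).
have := vol x 1 s t 0 z x0 x1 (lexx _) s0 st t1 (lexx _) z0 z1.
have := vol x 1 s t z 1 x0 x1 (lexx _) s0 st t1 z0 z1 (lexx _).
rewrite -!CF// -!CG//.
have [_ [-> _]] := C1 _ us; have [_ [-> _]] := C1 _ ut.
have u0 : unit_int (0 : R) by apply/andP; split; lra.
have C0E v : unit_int v -> [/\ C 0 v z = 0, C 0 v 1 = 0 & C 0 v 0 = 0].
  by move=> uv; have [-> _] := C0 v z uv uz; have [-> _] := C0 v 1 uv u1;
    have [-> _] := C0 v 0 uv u0.
have C_0E v : unit_int v -> C x v 0 = 0 /\ C 1 v 0 = 0.
  by move=> uv; have [_ [_ ->]] := C0 x v ux uv; have [_ [_ ->]] := C0 1 v u1 uv.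
have [-> -> ->] := C0E s us; have [-> -> ->] := C0E t ut.
have [-> ->] := C_0E s us; have [-> ->] := C_0E t ut.
by split; lra.
Qed.

(** One triple of the family, with the middle coordinate as integration variable. As [C x 0 z = 0]
    and [C x 1 z = D x z], the bounds over [[0, y]] give the first entries of the maximum and
    minimum, those over [[y, 1]] the second. *)
Lemma copula3_star_bounds (C : R -> R -> R -> R) (A B D : R -> R -> R) (x y z : R) :
  is_copula3 C -> unit_int x -> unit_int y -> unit_int z ->
  (forall t, unit_int t -> C x t 1 = A x t) ->
  (forall t, unit_int t -> C 1 t z = B t z) -> C x 1 z = D x z ->
  Num.max (star (@W2 R) A B x y z)
          (star (@M2 R) A B x y z + D x z - ast (@M2 R) A B x z) <= C x y z /\
  C x y z <= Num.min (star (@M2 R) A B x y z)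
          (star (@W2 R) A B x y z + D x z - ast (@W2 R) A B x z).
Proof.
move=> hC ux uy uz CA CB <-.
have [] : [/\ star (@W2 R) A B x y z <= C x y z - C x 0 z,
    C x y z - C x 0 z <= star (@M2 R) A B x y z,
    ast (@W2 R) A B x z - star (@W2 R) A B x y z <= C x 1 z - C x y z &
    C x 1 z - C x y z <= ast (@M2 R) A B x z - star (@M2 R) A B x y z].
  exact: coupled_integral_bounds (copula3_section_coupled hC ux uz CA CB) uy.
have [_ [-> _]] := hC.1 _ _ ux uz => ? ? ? ?.
by rewrite ge_max le_min; split; apply/andP; split; lra.
Qed.

Lemma is_copula3_swap23 (C : R -> R -> R -> R) :
  is_copula3 C -> is_copula3 (fun x y z => C x z y).
Proof.
move=> [C0 [C1 vol]]; split; [|split].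
- by move=> u v uu uv; have [? [? ?]] := C0 u v uu uv; have [? [? ?]] := C0 v u uv uu.
- by move=> u /C1[? [? ?]].
- move=> a1 b1 a2 b2 a3 b3 h1 h2 h3 h4 h5 h6 h7 h8 h9.
  by have := vol _ _ _ _ _ _ h1 h2 h3 h7 h8 h9 h4 h5 h6; lra.
Qed.

Lemma is_copula3_swap12 (C : R -> R -> R -> R) :
  is_copula3 C -> is_copula3 (fun x y z => C y x z).
Proof.
move=> [C0 [C1 vol]]; split; [|split].
- by move=> u v uu uv; have [? [? ?]] := C0 u v uu uv; have [? [? ?]] := C0 v u uv uu.
- by move=> u /C1[? [? ?]].
- move=> a1 b1 a2 b2 a3 b3 h1 h2 h3 h4 h5 h6 h7 h8 h9.
  by have := vol _ _ _ _ _ _ h4 h5 h6 h1 h2 h3 h7 h8 h9; lra.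
Qed.

End coupling.

Unset Implicit Arguments.

Theorem theorem5p3 (R : realType) (C12 C13 C23 : R -> R -> R)
  (h12 : is_copula2 C12) (h13 : is_copula2 C13) (h23 : is_copula2 C23)
  (hcomp : compatible C12 C13 C23)
  (Ct : R -> R -> R -> R) (hCt : is_copula3 Ct)
  (hmarg : has_margins Ct C12 C13 C23) :
  forall u1 u2 u3 : R, unit_int u1 -> unit_int u2 -> unit_int u3 ->
    C_L C12 C13 C23 u1 u2 u3 <= Ct u1 u2 u3 /\
    Ct u1 u2 u3 <= C_U C12 C13 C23 u1 u2 u3.
Proof.
move=> u1 u2 u3 U1 U2 U3.
have [m12 m13 m23] : [/\ forall u v, unit_int u -> unit_int v -> Ct u v 1 = C12 u v,
    forall u v, unit_int u -> unit_int v -> Ct u 1 v = C13 u v &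
    forall u v, unit_int u -> unit_int v -> Ct 1 u v = C23 u v].
  have I1 : unit_int (1 : R) by rewrite /unit_int ler01 lexx.
  by split=> u v uu uv; have [] := hmarg u v 1 uu uv I1; have [] := hmarg u 1 v uu I1 uv;
    have [] := hmarg 1 u v I1 uu uv; intuition.
have [l123 r123] : lower_term C12 C13 C23 u1 u2 u3 1 2 3 <= Ct u1 u2 u3 /\
    Ct u1 u2 u3 <= upper_term C12 C13 C23 u1 u2 u3 1 2 3.
  exact: (copula3_star_bounds (A := C12) (B := C23) (D := C13) hCt U1 U2 U3
    (fun t => m12 _ _ U1) (fun t ut => m23 _ _ ut U3) (m13 _ _ U1 U3)).
have [l132 r132] : lower_term C12 C13 C23 u1 u2 u3 1 3 2 <= Ct u1 u2 u3 /\
    Ct u1 u2 u3 <= upper_term C12 C13 C23 u1 u2 u3 1 3 2.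
  (* Swapping the last two coordinates puts the third in the middle, so the second factor is the
     transpose of [C23]. *)
  exact: (copula3_star_bounds (A := C13) (B := fun u v => C23 v u) (D := C12)
    (is_copula3_swap23 hCt) U1 U3 U2
    (fun t => m13 _ _ U1) (fun t ut => m23 _ _ U2 ut) (m12 _ _ U1 U2)).
have [l213 r213] : lower_term C12 C13 C23 u1 u2 u3 2 1 3 <= Ct u1 u2 u3 /\
    Ct u1 u2 u3 <= upper_term C12 C13 C23 u1 u2 u3 2 1 3.
  (* Swapping the first two coordinates puts the first in the middle, so the first factor is the
     transpose of [C12]. *)
  exact: (copula3_star_bounds (A := fun u v => C12 v u) (B := C13) (D := C23)
    (is_copula3_swap12 hCt) U2 U1 U3
    (fun t ut => m12 _ _ ut U2) (fun t ut => m13 _ _ ut U3) (m23 _ _ U2 U3)).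
(* [ge_max] and [le_min] are applied to variables: rewriting under the integrals
   makes unification unfold them. *)
have le_max3 (a b c e : R) : a <= e -> b <= e -> c <= e -> Num.max a (Num.max b c) <= e.
  by rewrite !ge_max => -> -> ->.
have le_min3 (a b c e : R) : e <= a -> e <= b -> e <= c -> e <= Num.min a (Num.min b c).
  by rewrite !le_min => -> -> ->.
by split; [exact: le_max3 l123 l132 l213|exact: le_min3 r123 r132 r213].
Qed.
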